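(* Let $I\subset\mathbf{R}$ be an interval and let $T:I\to I$ be bijective. Let $a:I\to\mathbf{R}$ and $f:I\to\mathbf{R}$ be $C^1$ functions such that $$a(T(x))=a(x)+1\quad\text{and}\quad f(T(x))=f(x)\qquad\text{for all }x\in I .$$ Assume further that $a$ is injective. Then there exists a periodic function $P$ with period $1$ such that $f(x)=P(a(x))$ for all $x\in I$.
   Context: ''Periodic with period $1$'' means $P(y+1)=P(y)$ for all $y$; $1$ is not required to be the minimal period (so constant $P$ is allowed). *)

(* Defs.v *)
From mathcomp Require Import all_boot all_order all_algebra.
From mathcomp Require Import all_classical all_reals all_analysis.
Import Order.TTheory GRing.Theory Num.Theory.
Import numFieldNormedType.Exports.

Set Implicit Arguments.
Unset Strict Implicit.
Unset Printing Implicit Defensive.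

Local Open Scope classical_set_scope.
Local Open Scope ring_scope.

(* The limit is taken along points of I, so the derivative is one-sided at an
   endpoint belonging to I, and values of g outside I are irrelevant. *)
Definition has_derivative_on (R : realType) (I : set R) (g g' : R -> R) : Prop :=
  forall x, I x -> (g y - g x) / (y - x) @[y --> within I x^'] --> g' x.

Definition C1_on (R : realType) (I : set R) (g : R -> R) : Prop :=
  exists2 g' : R -> R, has_derivative_on I g g' & {within I, continuous g'}.

(* Main.v *)
(** Points of [I] at which [a] takes values differing by an integer lie on one
    orbit of [T]: if a z + n = a x + m with n, m natural, then
    a (T^n z) = a (T^m x), hence T^n z = T^m x because [a] is injective, and so
    f z = f x.  Thus [f x] depends only on [a x] modulo 1. *)

Require Import Defs.
From mathcomp Require Import all_boot all_order all_algebra.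
From mathcomp Require Import all_classical all_reals all_analysis.
Import Order.TTheory GRing.Theory Num.Theory.
Import numFieldNormedType.Exports.

Set Implicit Arguments.
Unset Strict Implicit.
Unset Printing Implicit Defensive.

Local Open Scope classical_set_scope.
Local Open Scope ring_scope.

Lemma iter_set_fun (U : Type) (I : set U) (T : U -> U) (n : nat) (x : U) :
  set_fun I I T -> I x -> I (iter n T x).
Proof. by move=> TI Ix; elim: n => //= n; apply: TI. Qed.

(** The constant [c] is kept general to cover both [a] ([c = 1]) and the invariant [f] ([c = 0]). *)
Lemma iter_translation (R : pzRingType) (U : Type) (I : set U) (T : U -> U)
    (g : U -> R) (c : R) (n : nat) (x : U) :
  set_fun I I T -> (forall x, I x -> g (T x) = g x + c) ->
  I x -> g (iter n T x) = g x + c *+ n.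
Proof.
move=> TI gT Ix; elim: n => [|n IHn]; first by rewrite mulr0n addr0.
by rewrite iterS gT ?IHn ?mulrSr ?addrA//; exact: iter_set_fun.
Qed.

Theorem theorem5 (R : realType) (I : set R) (T a f : R -> R)
  (hI : is_interval I)
  (hT : set_bij I I T)
  (ha : C1_on I a)
  (hf : C1_on I f)
  (haT : forall x, I x -> a (T x) = a x + 1)
  (hfT : forall x, I x -> f (T x) = f x)
  (ainj : set_inj I a) :
  exists2 P : R -> R, periodic P 1 & forall x, I x -> f x = P (a x).
Proof.
have [TI _ _] := hT.
have aTn n x : I x -> a (iter n T x) = a x + n%:R.
  exact: iter_translation.
have fTn n x : I x -> f (iter n T x) = f x.
  move=> Ix; rewrite (iter_translation (c := 0) n TI _ Ix) ?mul0rn ?addr0//.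
  by move=> z Iz; rewrite hfT ?addr0.
(* [fiber y] is the set of x in I with a x - y an integer; two naturals n, m
   encode the integer, so that only forward iterates of T are needed. *)
pose fiber (y : R) :=
  [set x | I x /\ exists n m : nat, a x + n%:R = y + m%:R].
exists (fun y => f (xget 0 (fiber y))) => [y|x Ix].
  (* Equal sets yield the same chosen point, and the same default [0] when the fiber is empty, so
     periodicity holds at every real [y]. *)
  suff -> : fiber (y + 1) = fiber y by [].
  apply/seteqP; split=> x [Ix [n [m e]]]; split=> //.
    by exists n, m.+1; rewrite e -addrA nat1r.
  by exists n.+1, m; rewrite -natr1 addrA e addrAC.
(* The default does not occur here: [x] itself lies in [fiber (a x)], with both naturals zero. *)
have : fiber (a x) (xget 0 (fiber (a x))).
  by apply: (@xgetPex _ 0); exists x; split=> //; exists 0%N, 0%N.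
move: (xget _ _) => z [Iz [n [m e]]].
rewrite -(fTn m x Ix) -(fTn n z Iz); congr (f _).
apply: ainj; rewrite ?inE; try exact: iter_set_fun.
by rewrite !aTn.
Qed.
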